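(* Let $L$ be a complete lattice which is strictly nondistributive, i.e. there exist $\alpha,\beta,x\in L$ with $x\wedge(\alpha\vee\beta)\not\le (x\wedge\alpha)\vee(x\wedge\beta)$ and $x\not\le\alpha\vee\beta$. Then there exists a complete sublattice of $L$ which is isomorphic to $\overline{\mathsf N}_5$, $\overline{\mathsf M}_3$, $\overline{\mathsf L}_6$ or $\overline{\mathsf L}_7$.
   Context: Complete sublattice: everything is taken in the category of complete lattices and join-preserving maps. A complete sublattice $S$ of a complete lattice $L$ is a subset $S\subseteq L$ that is a complete lattice and for which the inclusion map $S\hookrightarrow L$ preserves arbitrary joins (including the empty join, so $\bot_L\in S$); meets in $S$ need not be meets in $L$. Isomorphic means isomorphic as (complete) lattices. The lattices (each given by its covering relations, $u\prec v$ meaning $v$ covers $u$): - $\overline{\mathsf N}_5$ (7 elements $\bot,\alpha,\beta,\gamma,x,\top,\overline\top$): $\bot\prec\alpha\prec\gamma\prec\top\prec\overline\top$, $\bot\prec\beta\prec\top$, $\gamma\prec x\prec\overline\top$. - $\overline{\mathsf M}_3$ (7 elements $\bot,\alpha,\beta,\gamma,x,\top,\overline\top$): $\bot\prec\alpha,\beta,\gamma$; $\alpha,\beta,\gamma\prec\top\prec\overline\top$; $\gamma\prec x\prec\overline\top$. - $\overline{\mathsf L}_6$ (8 elements $\bot,\alpha,\beta,\gamma,\delta,x,\top,\overline\top$, with $\delta=\alpha\vee\gamma$): $\bot\prec\alpha,\beta,\gamma$; $\alpha,\gamma\prec\delta\prec\top$; $\beta\prec\top\prec\overline\top$; $\gamma\prec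 x\prec\overline\top$. - $\overline{\mathsf L}_7$ (9 elements $\bot,\alpha,\beta,\gamma,\delta,\varepsilon,x,\top,\overline\top$, with $\delta=\alpha\vee\gamma$ and $\varepsilon=\beta\vee\gamma$): $\bot\prec\alpha,\beta,\gamma$; $\alpha,\gamma\prec\delta\prec\top$; $\beta,\gamma\prec\varepsilon\prec\top$; $\top\prec\overline\top$; $\gamma\prec x\prec\overline\top$. *)

(* Defs.v *)
From HB Require Import structures.
From mathcomp Require Import all_boot all_order.
From mathcomp Require Import boolp classical_sets.

Set Implicit Arguments.
Unset Strict Implicit.
Unset Printing Implicit Defensive.

Import Order.TTheory.

Local Open Scope classical_set_scope.
Local Open Scope order_scope.

(* A subset is given the order induced by the ambient poset. *)
HB.instance Definition _ (T : choiceType) (S : set T) :=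
  SubChoice.on (set_type S).
HB.instance Definition _ (d : Order.disp_t) (T : porderType d) (S : set T) :=
  [SubChoice_isSubPOrder of set_type S by <: with d].

Definition complete_lattice (d : Order.disp_t) (T : porderType d) : Prop :=
  forall A : set T, (exists s, supremums A s) /\ (exists i, infimums A i).

Section Morphisms.
Variables (d d' : Order.disp_t) (T : porderType d) (U : porderType d').

(* The empty family is included: for A = set0 these say that the least, resp.
   greatest, element is preserved. *)
Definition preserves_joins (f : T -> U) : Prop :=
  forall (A : set T) (s : T), supremums A s -> supremums (f @` A) (f s).

Definition preserves_meets (f : T -> U) : Prop :=
  forall (A : set T) (i : T), infimums A i -> infimums (f @` A) (f i).

End Morphisms.

Definition lattice_isomorphic (d d' : Order.disp_t)
    (T : porderType d) (U : porderType d') : Prop :=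
  exists f : T -> U, [/\ bijective f, preserves_joins f & preserves_meets f].

(* Meets of S are not required to be meets of T. *)
Definition complete_sublattice (d : Order.disp_t) (T : porderType d)
    (S : set T) : Prop :=
  complete_lattice (set_type S) /\ preserves_joins (val : set_type S -> T).

Definition strictly_nondistributive (d : Order.disp_t) (L : latticeType d) :
    Prop :=
  exists alpha beta x : L,
    ~~ (x `&` (alpha `|` beta) <= (x `&` alpha) `|` (x `&` beta)) /\
    ~~ (x <= alpha `|` beta).

(* v_ttop stands for the element written top with an overline. *)
Inductive vertex : Type :=
  v_bot | v_alpha | v_beta | v_gamma | v_delta | v_epsilon
  | v_x | v_top | v_ttop.

Definition vertex_rank (v : vertex) : nat :=
  match v with
  | v_bot => 0 | v_alpha => 1 | v_beta => 2 | v_gamma => 3 | v_delta => 4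
  | v_epsilon => 5 | v_x => 6 | v_top => 7 | v_ttop => 8
  end.

Definition vertex_of_rank (n : nat) : vertex :=
  nth v_bot [:: v_bot; v_alpha; v_beta; v_gamma; v_delta; v_epsilon;
                v_x; v_top; v_ttop] n.

Lemma vertex_rankK : cancel vertex_rank vertex_of_rank.
Proof. by case. Qed.

HB.instance Definition _ := Countable.copy vertex (can_type vertex_rankK).

(* A Hasse diagram: a pair (u, v) in hasse_covers says that v covers u.  The
   last field guarantees acyclicity, hence that the generated preorder is
   antisymmetric. *)
Record hasse : Type := Hasse {
  hasse_vertices : seq vertex;
  hasse_covers : seq (vertex * vertex);
  hasse_ranked :
    all (fun p => vertex_rank p.1 < vertex_rank p.2)%N hasse_covers
}.

Definition hasse_elt (H : hasse) : Type := seq_sub (hasse_vertices H).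
Coercion hasse_elt : hasse >-> Sortclass.

HB.instance Definition _ (H : hasse) := Finite.on (hasse_elt H).
HB.instance Definition _ (H : hasse) := SubType.on (hasse_elt H).

Definition hasse_cover (H : hasse) : rel H :=
  fun u v => (val u, val v) \in hasse_covers H.

(* The order is the reflexive transitive closure of the covering relation. *)
Definition hasse_le (H : hasse) : rel H := connect (@hasse_cover H).

Section HasseOrder.
Variable H : hasse.

Lemma hasse_cover_rank (u v : H) :
  hasse_cover u v -> (vertex_rank (val u) < vertex_rank (val v))%N.
Proof. by move=> /(allP (hasse_ranked H)). Qed.

Lemma hasse_le_rank (u v : H) :
  hasse_le u v -> u = v \/ (vertex_rank (val u) < vertex_rank (val v))%N.
Proof.
case/connectP=> p; elim: p u => [|w p IHp] u /=; first by move=> _ ->; left.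
case/andP=> /hasse_cover_rank uw wp vE; right.
by have [<-//|] := IHp w wp vE; apply: ltn_trans.
Qed.

Lemma hasse_le_refl : reflexive (@hasse_le H).
Proof. exact: connect0. Qed.

Lemma hasse_le_trans : transitive (@hasse_le H).
Proof. exact: connect_trans. Qed.

Lemma hasse_le_anti : antisymmetric (@hasse_le H).
Proof.
move=> u v /andP[/hasse_le_rank[//|uv] /hasse_le_rank[//|vu]].
by have := ltn_trans uv vu; rewrite ltnn.
Qed.

Fact hasse_display : Order.disp_t. Proof. exact: Order.Disp tt tt. Qed.

HB.instance Definition _ :=
  Order.Le_isPOrder.Build hasse_display (hasse_elt H)
    hasse_le_refl hasse_le_anti hasse_le_trans.

End HasseOrder.

Definition N5bar : hasse := @Hasse
  [:: v_bot; v_alpha; v_beta; v_gamma; v_x; v_top; v_ttop]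
  [:: (v_bot, v_alpha); (v_alpha, v_gamma); (v_gamma, v_top); (v_top, v_ttop);
      (v_bot, v_beta); (v_beta, v_top);
      (v_gamma, v_x); (v_x, v_ttop)]
  isT.

Definition M3bar : hasse := @Hasse
  [:: v_bot; v_alpha; v_beta; v_gamma; v_x; v_top; v_ttop]
  [:: (v_bot, v_alpha); (v_bot, v_beta); (v_bot, v_gamma);
      (v_alpha, v_top); (v_beta, v_top); (v_gamma, v_top); (v_top, v_ttop);
      (v_gamma, v_x); (v_x, v_ttop)]
  isT.

Definition L6bar : hasse := @Hasse
  [:: v_bot; v_alpha; v_beta; v_gamma; v_delta; v_x; v_top; v_ttop]
  [:: (v_bot, v_alpha); (v_bot, v_beta); (v_bot, v_gamma);
      (v_alpha, v_delta); (v_gamma, v_delta); (v_delta, v_top);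
      (v_beta, v_top); (v_top, v_ttop);
      (v_gamma, v_x); (v_x, v_ttop)]
  isT.

Definition L7bar : hasse := @Hasse
  [:: v_bot; v_alpha; v_beta; v_gamma; v_delta; v_epsilon; v_x; v_top; v_ttop]
  [:: (v_bot, v_alpha); (v_bot, v_beta); (v_bot, v_gamma);
      (v_alpha, v_delta); (v_gamma, v_delta); (v_delta, v_top);
      (v_beta, v_epsilon); (v_gamma, v_epsilon); (v_epsilon, v_top);
      (v_top, v_ttop);
      (v_gamma, v_x); (v_x, v_ttop)]
  isT.

(* The four diagrams do define complete lattices.  Since fintype.connect does
   not compute, the order is first compared with a computable closure. *)
Fixpoint hasse_reach (E : seq (vertex * vertex)) (n : nat) (u v : vertex) :
    bool :=
  (u == v) || (if n is n'.+1
               then has (fun p => (p.1 == u) && hasse_reach E n' p.2 v) E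
               else false).

Definition hasse_lattice_check (H : hasse) : bool :=
  let V := hasse_vertices H in
  let E := hasse_covers H in
  let le := hasse_reach E 9 in
  [&& all (fun p => (p.1 \in V) && (p.2 \in V)) E,
      has (fun b => all (le b) V) V &
      all (fun u => all (fun v => has (fun w =>
        [&& le u w, le v w &
          all (fun z => le u z && le v z ==> le w z) V]) V) V) V].

Section HasseComplete.
Variable H : hasse.
Hypothesis wfH : hasse_lattice_check H.

Let E := hasse_covers H.
Let V := hasse_vertices H.

Lemma hasse_reach_le n (u v : H) : hasse_reach E n (val u) (val v) -> u <= v.
Proof.
elim: n u => [|n IHn] u /=; first by rewrite orbF => /eqP/val_inj->.
case/orP=> [/eqP/val_inj->//|/hasP[[a b] abE /= /andP[/eqP ua bv]]].
have /and3P[/allP/(_ _ abE)/andP[/= _ bV] _ _] := wfH.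
pose w : H := SeqSub bV.
have uw : u <= w by apply: connect1; rewrite /hasse_cover /= -ua.
exact: le_trans uw (IHn w bv).
Qed.

Lemma le_hasse_reach (u v : H) : u <= v -> hasse_reach E 9 (val u) (val v).
Proof.
have H9 : (9 <= 9 + vertex_rank (val u))%N by rewrite leq_addr.
move=> /connectP[p]; move: {2 3}9%N H9 => n.
elim: n u p => [|n IHn] u [|w p] /=.
- by move=> _ _ ->; rewrite eqxx.
- by rewrite add0n; case: (ssval u).
- by move=> _ _ ->; rewrite eqxx.
move=> nu /andP[uw wp] vE; apply/orP; right; apply/hasP.
exists (val u, val w) => //=; rewrite eqxx /=.
apply: IHn wp vE; apply: leq_trans nu _.
by rewrite addSnnS leq_add2l hasse_cover_rank.
Qed.

Lemma hasse_leE (u v : H) : (u <= v) = hasse_reach E 9 (val u) (val v).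
Proof. by apply/idP/idP; [exact: le_hasse_reach|exact: hasse_reach_le]. Qed.

Let seq_lub (s : seq H) :
  exists w, forall z, (w <= z) = all (fun u => u <= z) s.
Proof.
have /and3P[_ /hasP[b bV /allP b_min] /allP lubP] := wfH.
elim: s => [|u s [v vP]].
  by exists (SeqSub bV : H) => z; rewrite hasse_leE; exact: b_min (valP z).
have /allP/(_ _ (valP v))/hasP[w wV /and3P[uw vw /allP w_min]] :=
  lubP _ (valP u).
exists (SeqSub wV : H) => z /=; rewrite -vP; apply/idP/andP => [wz|[uz vz]].
  by split; apply: le_trans wz; rewrite hasse_leE.
by rewrite hasse_leE; apply: (implyP (w_min _ (valP z))); rewrite -!hasse_leE uz.
Qed.

Lemma hasse_supremums (A : set H) : exists s, supremums A s.
Proof.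
have [w wP] := seq_lub [seq u <- enum {: H} | `[< A u >]].
have ubE z : ubound A z <-> w <= z.
  rewrite wP; split=> [Az|/allP Az u Au].
    by apply/allP=> u; rewrite mem_filter => /andP[/asboolP/Az].
  by apply: Az; rewrite mem_filter mem_enum andbT; apply/asboolP.
by exists w; split=> [|z]; [exact/ubE|move/ubE].
Qed.

Lemma hasse_complete_lattice : complete_lattice H.
Proof.
move=> A; split; first exact: hasse_supremums.
have [i [iub imin]] := hasse_supremums (lbound A).
exists i; split=> [u Au|z]; last exact: iub.
by apply: imin => z; apply.
Qed.

End HasseComplete.

Lemma N5bar_complete_lattice : complete_lattice N5bar.
Proof. exact: hasse_complete_lattice. Qed.

Lemma M3bar_complete_lattice : complete_lattice M3bar.
Proof. exact: hasse_complete_lattice. Qed.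

Lemma L6bar_complete_lattice : complete_lattice L6bar.
Proof. exact: hasse_complete_lattice. Qed.

Lemma L7bar_complete_lattice : complete_lattice L7bar.
Proof. exact: hasse_complete_lattice. Qed.

(* Main.v *)
Require Import Defs.
From HB Require Import structures.
From mathcomp Require Import all_boot all_order.
From mathcomp Require Import boolp classical_sets.

(** Put [g = x `&` (a `|` b)].  If [b] is not below [x `|` a], then
    [a < g `|` a < x `|` a] together with [b] generates a copy of N5bar under
    joins.  If neither this nor its mirror image occurs, then
    [x `|` a = x `|` b], the elements [a], [b], [g] form an antichain, and the
    sublattice generated by [a], [b], [g], [x] under joins is determined by
    which of [a `|` g] and [b `|` g] equal [a `|` b]. *)

Set Implicit Arguments.
Unset Strict Implicit.
Unset Printing Implicit Defensive.

Import Order.TTheory.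

Local Open Scope classical_set_scope.
Local Open Scope order_scope.

(** * Order isomorphisms and finite join-closed subsets *)

Section OrderIsomorphism.
Variables (d d' : Order.disp_t) (T : porderType d) (U : porderType d').
Variables (f : T -> U) (g : U -> T).
Hypotheses (fK : cancel f g) (gK : cancel g f) (f_mono : {mono f : x y / x <= y}).

Lemma order_iso_lattice_isomorphic : lattice_isomorphic T U.
Proof.
(* [f] is adjoint to [g] on both sides, which carries upper and lower bounds across [f]. *)
have le_fg x y : (f x <= y) = (x <= g y) by rewrite -{1}[y]gK f_mono.
have le_gf x y : (y <= f x) = (g y <= x) by rewrite -{1}[y]gK f_mono.
exists f; split; first by exists g.
- move=> A s [ubs mins]; split=> [_ [x Ax <-]|z ubz];
    first by rewrite f_mono; exact: ubs.
  by rewrite le_fg; apply: mins => x Ax; rewrite -le_fg; apply: ubz; exists x.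
- move=> A i [lbi maxi]; split=> [_ [x Ax <-]|z lbz];
    first by rewrite f_mono; exact: lbi.
  by rewrite le_gf; apply: maxi => x Ax; rewrite -le_gf; apply: lbz; exists x.
Qed.

End OrderIsomorphism.

Lemma supremums_complete_lattice (d : Order.disp_t) (T : porderType d) :
  (forall A : set T, exists s, supremums A s) -> complete_lattice T.
Proof.
move=> supT A; split; first exact: supT.
have [i [ubi mini]] := supT (lbound A).
by exists i; split=> [x Ax|z]; [apply: mini => z; apply|exact: ubi].
Qed.

(** Subsets of a finite list have joins by iterating binary joins from [b], the empty join. These
    joins of [L] stay in [s], so they are also the joins of the subset. *)
Lemma finite_complete_sublattice (d : Order.disp_t) (L : latticeType d)
    (s : seq L) (b : L) :
    b \in s -> (forall z, b <= z) ->
    {in s &, forall u v, u `|` v \in s} ->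
  complete_sublattice [set` s].
Proof.
move=> bs b_min sU; set S := [set` s].
have supS (A : set (set_type S)) :
    exists w : set_type S, supremums (val @` A) (val w).
  have lub (r : seq L) : {subset r <= s} ->
      exists2 w, w \in s & forall z, (w <= z) = all (fun u => u <= z) r.
    elim: r => [|u r IHr] rs; first by exists b => // z; rewrite b_min.
    have [v|w ws wP] := IHr; first by move=> vr; apply: rs; rewrite inE vr orbT.
    exists (u `|` w) => [|z /=]; first by apply: sU => //; rewrite rs ?mem_head.
    by rewrite leUx wP.
  have [u|w ws wP] := lub [seq u <- s | `[< (val @` A) u >]].
    by rewrite mem_filter => /andP[].
  have ubE z : ubound (val @` A) z <-> w <= z.
    rewrite wP; split=> [Az|/allP Az u Au].
      by apply/allP=> u; rewrite mem_filter => /andP[/asboolP/Az].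
    apply: Az; rewrite mem_filter; apply/andP; split; first exact/asboolP.
    by have [v _ <-] := Au; have := valP v; rewrite inE.
  exists (SigSub (mem_set ws : w \in S)).
  by split=> [|z] /=; [apply/ubE|move/ubE].
have valS (A : set (set_type S)) (w : set_type S) :
    supremums (val @` A) (val w) -> supremums A w.
  case=> ubw minw; split=> [u Au|z ubz];
    first by rewrite -Order.le_val; apply: ubw; exists u.
  by rewrite -Order.le_val; apply: minw => _ [u Au <-];
    rewrite Order.le_val; exact: ubz.
split;
    first by apply: supremums_complete_lattice => A; have [w /valS] := supS A; exists w.
move=> A t [ubt mint]; have [w wA] := supS A; have [ubw minw] := valS _ _ wA.
(* Suprema in [set_type S] are unique, and the value of [w] is already the supremum in [L]. *)
suff -> : t = w by [].
by apply: le_anti; rewrite mint// minw.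
Qed.

(* Decides that a map [F] from the vertices of [H] is a join-preserving
   embedding as soon as it is monotone along covers, [~~ (F p.1 <= F p.2)] for
   [p] in [N], and [F q.2 <= F q.1.1 `|` F q.1.2] for [q] in [J]. *)
Definition embedding_check (H : hasse) (N : seq (vertex * vertex))
    (J : seq (vertex * vertex * vertex)) : bool :=
  let V := hasse_vertices H in
  let le := hasse_reach (hasse_covers H) 9 in
  [&& v_bot \in V,
      all (fun u => all (fun v =>
        le u v || has (fun p => le p.1 u && le v p.2) N) V) V &
      all (fun u => all (fun v => has (fun w => [&& le u w, le v w &
        [|| le w u, le w v | has (fun q => le w q.2 &&
           (le q.1.1 u && le q.1.2 v || le q.1.1 v && le q.1.2 u)) J]]) V) V) V].

(** * From finite checks on a diagram to a copy of it inside a lattice *)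

Section Embedding.
Variables (d : Order.disp_t) (L : latticeType d) (H : hasse) (F : vertex -> L).
Variables (N : seq (vertex * vertex)) (J : seq (vertex * vertex * vertex)).
Hypotheses (wfH : hasse_lattice_check H) (HNJ : embedding_check H N J).
Hypothesis F_bot : forall z, F v_bot <= z.
Hypothesis F_cover : all (fun p => F p.1 <= F p.2) (hasse_covers H).
Hypothesis F_nle : all (fun p => ~~ (F p.1 <= F p.2)) N.
Hypothesis F_join : all (fun q => F q.2 <= F q.1.1 `|` F q.1.2) J.

Let V := hasse_vertices H.
Local Notation reach := (hasse_reach (hasse_covers H)).

Lemma reach_homo n u v : reach n u v -> F u <= F v.
Proof.
elim: n u => [|n IHn] u /=; first by rewrite orbF => /eqP->.
case/orP=> [/eqP->//|/hasP[[a b] abE /= /andP[/eqP <- /IHn]]].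
by apply: le_trans; have /= := allP F_cover _ abE.
Qed.

(** If [v] is not reachable from [u], some [p] in [N] has [p.1] below [u] and [v] below [p.2], so
    [F u <= F v] would force the excluded [F p.1 <= F p.2]. Hence [N] need only list extremal
    non-relations. *)
Lemma reach_mono : {in V &, forall u v, (F u <= F v) = reach 9 u v}.
Proof.
move=> u v uV vV; apply/idP/idP; last exact: reach_homo.
have /and3P[_ /allP/(_ u uV)/allP/(_ v vV) uvN _] := HNJ => Fuv.
case/orP: uvN => // /hasP[p pN /andP[/reach_homo pu /reach_homo vp]].
by have /negP[] := allP F_nle _ pN; exact: le_trans (le_trans pu Fuv) vp.
Qed.

(** The check supplies an upper bound [w] of [u] and [v]. The converse bound on [F w] is immediate
    if [w] lies below [u] or [v], and otherwise comes from an inequality in [J], up to swapping [u]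
    and [v]. *)
Lemma reach_join : {in V &, forall u v, F u `|` F v \in map F V}.
Proof.
move=> u v uV vV.
have /and3P[_ _ /allP/(_ u uV)/allP/(_ v vV)/hasP[w wV]] := HNJ.
case/and3P=> /reach_homo uw /reach_homo vw wuv.
suff -> : F u `|` F v = F w by exact: map_f.
apply/eqP; rewrite eq_le leUx uw vw /=; case/or3P: wuv.
- by move/reach_homo/le_trans; apply; exact: leUl.
- by move/reach_homo/le_trans; apply; exact: leUr.
case/hasP=> q qJ /andP[/reach_homo wq quv].
apply: le_trans wq (le_trans (allP F_join _ qJ) _).
by case/orP: quv => /andP[/reach_homo qu /reach_homo qv]; [|rewrite joinC];
  rewrite leU2.
Qed.

Lemma embedding_sublattice :
  exists S : set L, complete_sublattice S /\ lattice_isomorphic S H.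
Proof.
exists [set` map F V]; split.
  apply: (@finite_complete_sublattice _ _ _ (F v_bot)) => //.
    by apply: map_f; have /and3P[] := HNJ.
  by move=> _ _ /mapP[u uV ->] /mapP[v vV ->]; exact: reach_join.
have /boolp.choice[g gK] : forall s : set_type [set` map F V],
    exists u : H, F (val u) = val s.
  by move=> s; have := valP s; rewrite inE => /mapP[u uV ->]; exists (SeqSub uV).
have FV (u : H) : F (val u) \in [set` map F V].
  by rewrite inE; apply: map_f; exact: valP.
have Fmono (u v : H) : (F (val u) <= F (val v)) = (u <= v).
  by rewrite (hasse_leE wfH) reach_mono //; exact: valP.
apply: (@order_iso_lattice_isomorphic _ _ _ _ g (fun u => SigSub (FV u))).
- by move=> s; apply: val_inj; rewrite /= gK.
(* [F] is injective on vertices because it reflects the order. *)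
- by move=> u; apply: le_anti; rewrite -!Fmono gK lexx.
- by move=> s t; rewrite -Fmono !gK Order.le_val.
Qed.

End Embedding.

(** * The four configurations, each given by its extremal non-relations and its joins *)

Section Configurations.
Variables (d : Order.disp_t) (L : latticeType d) (o : L).
Hypothesis o_min : forall z, o <= z.

(** Both tops are forced to be joins. Where a diagram lacks [v_delta] or [v_epsilon], [o] is passed
    as a filler. *)
Definition assign (a b g del eps x : L) (v : vertex) : L :=
  match v with
  | v_bot => o | v_alpha => a | v_beta => b | v_gamma => g
  | v_delta => del | v_epsilon => eps | v_x => x
  | v_top => a `|` b | v_ttop => x `|` (a `|` b)
  end.

Variables a b g x : L.
Hypotheses (gx : g <= x) (gab : g <= a `|` b) (xab : ~~ (x <= a `|` b)).

Lemma N5bar_sublattice : a <= g -> ~~ (g <= a) -> ~~ (g <= b) -> ~~ (b <= x) ->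
  exists S : set L, complete_sublattice S /\ lattice_isomorphic S N5bar.
Proof.
move=> ag ga gb bx.
(* Otherwise the join of [a] and [b] is [b], which would then lie above [g]. *)
have ab : ~~ (a <= b) by apply: contra gb => /join_idPr <-.
apply: (@embedding_sublattice _ _ _ (assign a b g o o x)
  [:: (v_beta, v_x); (v_x, v_top); (v_alpha, v_beta); (v_gamma, v_alpha)]
  [:: (v_alpha, v_beta, v_top); (v_x, v_beta, v_ttop)]) => //=.
- by rewrite !o_min ag gab leUr leUl leUr gx.
- by rewrite bx xab ab ga.
- by rewrite lexx !leUx leUl leUr (le_trans (le_trans ag gx)) ?leUl.
Qed.

Hypotheses (ga : ~~ (g <= a)) (gb : ~~ (g <= b)).
Hypotheses (ax : ~~ (a <= x)) (bx : ~~ (b <= x)).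
Hypotheses (bxa : b <= x `|` a) (axb : a <= x `|` b).

Let ab : ~~ (a <= b). Proof. by apply: contra gb => /join_idPr <-. Qed.
Let ba : ~~ (b <= a). Proof. by apply: contra ga => /join_idPl <-. Qed.

Lemma M3bar_sublattice : b <= a `|` g -> a <= b `|` g ->
  exists S : set L, complete_sublattice S /\ lattice_isomorphic S M3bar.
Proof.
move=> bag abg.
apply: (@embedding_sublattice _ _ _ (assign a b g o o x)
  [:: (v_alpha, v_x); (v_beta, v_x); (v_x, v_top); (v_alpha, v_beta);
      (v_beta, v_alpha); (v_gamma, v_alpha); (v_gamma, v_beta)]
  [:: (v_alpha, v_beta, v_top); (v_alpha, v_gamma, v_top);
      (v_beta, v_gamma, v_top); (v_x, v_alpha, v_ttop);
      (v_x, v_beta, v_ttop)]) => //=.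
- by rewrite !o_min gab leUl !leUr leUl gx.
- by rewrite ax bx xab ab ba ga gb.
- by rewrite lexx !leUx !leUl !leUr bag abg bxa axb.
Qed.

(** Here [v_delta] splits off from [v_top], while the join of [b] and [g] is still the top; the
    mirror image is left to symmetry. *)
Lemma L6bar_sublattice : ~~ (b <= a `|` g) -> a <= b `|` g ->
  exists S : set L, complete_sublattice S /\ lattice_isomorphic S L6bar.
Proof.
move=> bag abg.
apply: (@embedding_sublattice _ _ _ (assign a b g (a `|` g) o x)
  [:: (v_alpha, v_x); (v_beta, v_x); (v_x, v_top); (v_alpha, v_beta);
      (v_beta, v_delta); (v_gamma, v_alpha); (v_gamma, v_beta)]
  [:: (v_alpha, v_beta, v_top); (v_alpha, v_gamma, v_delta);
      (v_beta, v_gamma, v_top); (v_x, v_alpha, v_ttop);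
      (v_x, v_beta, v_ttop)]) => //=.
- by rewrite !o_min [a `|` g <= _]leUx gab !leUl !leUr gx.
- by rewrite ax bx xab ab bag ga gb.
- by rewrite !lexx !leUx !leUl !leUr abg bxa axb.
Qed.

Lemma L7bar_sublattice : ~~ (b <= a `|` g) -> ~~ (a <= b `|` g) ->
  exists S : set L, complete_sublattice S /\ lattice_isomorphic S L7bar.
Proof.
move=> bag abg.
apply: (@embedding_sublattice _ _ _ (assign a b g (a `|` g) (b `|` g) x)
  [:: (v_alpha, v_x); (v_beta, v_x); (v_x, v_top); (v_alpha, v_epsilon);
      (v_beta, v_delta); (v_gamma, v_alpha); (v_gamma, v_beta)]
  [:: (v_alpha, v_beta, v_top); (v_alpha, v_gamma, v_delta);
      (v_beta, v_gamma, v_epsilon); (v_x, v_alpha, v_ttop);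
      (v_x, v_beta, v_ttop)]) => //=.
- by rewrite !o_min [a `|` g <= _]leUx [b `|` g <= _]leUx gab !leUl !leUr gx.
- by rewrite ax bx xab abg bag ga gb.
- by rewrite !lexx !leUx !leUl !leUr bxa axb.
Qed.

End Configurations.

Theorem proposition2p4 (d : Order.disp_t) (L : latticeType d)
    (L_complete : complete_lattice L)
    (L_snd : strictly_nondistributive L) :
  exists S : set L,
    complete_sublattice S /\
    (lattice_isomorphic S N5bar \/ lattice_isomorphic S M3bar \/
     lattice_isomorphic S L6bar \/ lattice_isomorphic S L7bar).
Proof.
have [o o_min] : exists o : L, forall z, o <= z.
  have [[o [_ o_min]] _] := L_complete set0.
  by exists o => z; apply: o_min => u [].
have [a [b [x [gab xab]]]] := L_snd.
(* The condition or its mirror image always holds: swapping [a] and [b] handles both the mirrored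
   [N5bar] case and the mirrored [L6bar] case. *)
wlog bag : a b gab xab / ~~ (b <= x `|` a) ||
    (a <= x `|` b) && ((b <= a `|` x `&` (a `|` b)) ==>
                       (a <= b `|` x `&` (a `|` b))).
  move=> wlg.
  have wlg' := wlg b a; rewrite [b `|` a]joinC [_ `|` (x `&` a)]joinC in wlg'.
  move: (wlg a b gab xab) (wlg' gab xab).
  case: (b <= x `|` a); case: (a <= x `|` b); case: (b <= a `|` _);
    case: (a <= b `|` _) => /= h h'; by [apply: h|apply: h'].
set g := x `&` (a `|` b) in gab bag.
have gx : g <= x by exact: leIl.
have gt : g <= a `|` b by exact: leIr.
have ga : ~~ (g <= a).
  by apply: contra gab => ga; apply: le_trans (leUl _ _); rewrite lexI gx.
have gb : ~~ (g <= b).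
  by apply: contra gab => gb; apply: le_trans (leUr _ _); rewrite lexI gx.
(* If both were below [x], the right-hand side in [gab] would be the join of [a] and [b], which lies
   above [g]. *)
have abx : ~~ ((a <= x) && (b <= x)).
  by apply: contra gab => /andP[/meet_idPr-> /meet_idPr->].
case/boolP: (b <= x `|` a) bag => [bxa /= /andP[axb bag]|bxa _].
  (* If [a <= x], then [bxa] gives [b <= x] as well, against [abx]; [bx] is symmetric. *)
  have ax : ~~ (a <= x).
    by apply: contra abx => ax; rewrite ax (le_trans bxa)// leUx lexx.
  have bx : ~~ (b <= x).
    by apply: contra abx => bx; rewrite bx (le_trans axb)// leUx lexx.
  case/boolP: (b <= a `|` g) bag => [bag /= abg|bag _].
    have [S [? ?]] := M3bar_sublattice o_min gx gt xab ga gb ax bx bxa axb bag abg.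
    by exists S; tauto.
  case/boolP: (a <= b `|` g) => abg.
    have [S [? ?]] := L6bar_sublattice o_min gx gt xab ga gb ax bx bxa axb bag abg.
    by exists S; tauto.
  have [S [? ?]] := L7bar_sublattice o_min gx gt xab ga gb ax bx bxa axb bag abg.
  by exists S; tauto.
(* Joining [a] to [g] and [x] puts both above [a]; the required non-inequalities survive since [g]
   and [x] only grow, and the last one is [bxa]. *)
have [|||||||S [? ?]] := @N5bar_sublattice _ L o o_min a b (g `|` a) (x `|` a).
- by rewrite leU2.
- by rewrite leUx gt leUl.
- by apply: contra xab; apply: le_trans; exact: leUl.
- exact: leUr.
- by apply: contra ga; apply: le_trans; exact: leUl.
- by apply: contra gb; apply: le_trans; exact: leUl.
- by [].
by exists S; tauto.
Qed.
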